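(* Let $q\in\mathbb{R}$ and assume that there is a tight Borel measurable $G:\Omega\to\ell^\infty(S)$ with $G_N\rightsquigarrow G$ weakly in $\ell^\infty(S)$. Then $$\liminf_{N\to\infty}\mathbb{P}_*\Big[\forall c\in\mathcal{F}(S):\ \hat{\mathcal{L}}_{c-\tau_Nq\sigma}\subseteq\mathcal{L}_c\ \wedge\ \hat{\mathcal{U}}_{c+\tau_Nq\sigma}\subseteq\mathcal{U}_c\Big]\ \ge\ \mathbb{P}\Big[\sup_{s\in S}|G(s)|<q\Big]$$ and $$\limsup_{N\to\infty}\mathbb{P}^*\Big[\forall c\in\mathcal{F}(S):\ \hat{\mathcal{L}}_{c-\tau_Nq\sigma}\subseteq\mathcal{L}_c\ \wedge\ \hat{\mathcal{U}}_{c+\tau_Nq\sigma}\subseteq\mathcal{U}_c\Big]\ \le\ \mathbb{P}\Big[\sup_{s\in S}|G(s)|\le q\Big].$$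
   Context: $(S,d)$ is a metric space (not assumed compact), $(\Omega,\mathfrak{P},\mathbb{P})$ a probability space, $\mathbb{P}_*,\mathbb{P}^*$ inner and outer probability. $\mathcal{F}(S)$ is the set of all functions $S\to\mathbb{R}\cup\{\pm\infty\}$, $\ell^\infty(S)$ the bounded real functions with the supremum norm. Weak convergence $\rightsquigarrow$ is in the Hoffmann-J{\o}rgensen sense. $\mu\in\ell^\infty(S)$ is the target; $\hat\mu_N:\Omega\to\ell^\infty(S)$ are (not necessarily measurable) estimators; $(\tau_N)$ is a positive real sequence converging to zero; $\sigma\in\ell^\infty(S)$ satisfies $0<\mathfrak{o}<\sigma(s)<\mathfrak{O}<\infty$ for all $s$; $G_N=(\hat\mu_N-\mu)/(\tau_N\sigma)$. For $f\in\mathcal{F}(S)$: $\mathcal{L}_f=\{s:\mu(s)<f(s)\}$, $\mathcal{U}_f=\{s:\mu(s)>f(s)\}$, and $\hat{\mathcal{L}}_f,\hat{\mathcal{U}}_f$ are the same sets with $\hat\mu_N$ in place of $\mu$. *)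

(* Defs.v *)
From HB Require Import structures.
From mathcomp Require Import all_boot all_order all_algebra.
From mathcomp Require Import all_classical all_reals all_analysis.
From mathcomp Require Import measurable_realfun.

Set Implicit Arguments.
Unset Strict Implicit.
Unset Printing Implicit Defensive.

Import Order.TTheory GRing.Theory Num.Theory.
Import numFieldNormedType.Exports.

Local Open Scope classical_set_scope.
Local Open Scope ring_scope.

(* l^oo(S), as a normedModType R for the supremum norm. *)

Lemma bounded_funP (S : Type) (R : realType) (f : S -> R) :
  bounded_fun f <-> exists M, forall s, `|f s| <= M.
Proof.
split=> [/pinfty_ex_gt0[M _ fM]|[M fM]]; first by exists M => s; exact: fM.
exists M; split; first exact: num_real.
by move=> x Mx s _; exact: le_trans (fM s) (ltW Mx).
Qed.

Definition bounded_pred (S : Type) (R : realType) : {pred S -> R} :=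
  fun f => `[< bounded_fun f >].
Arguments bounded_pred : clear implicits.

Record linf (S : Type) (R : realType) := Linf {
  linf_fun :> S -> R;
  linf_boundedP : linf_fun \in bounded_pred S R
}.

Section linf_lmodule.
Context (S : Type) (R : realType).

HB.instance Definition _ := [isSub for @linf_fun S R].
HB.instance Definition _ := [Choice of linf S R by <:].

Lemma bounded_submod_closed : submod_closed (bounded_pred S R).
Proof.
split; first by apply/asboolP/bounded_funP; exists 0 => s; rewrite normr0.
move=> a f g /asboolP/bounded_funP[M fM] /asboolP/bounded_funP[N gN].
apply/asboolP/bounded_funP; exists (`|a| * M + N) => s.
apply: le_trans (ler_normD _ _) _; apply: lerD => //.
by rewrite normrM ler_wpM2l.
Qed.

HB.instance Definition _ :=
  GRing.isSubmodClosed.Build R (S -> R) (bounded_pred S R)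
    bounded_submod_closed.
HB.instance Definition _ := [SubChoice_isSubLmodule of linf S R by <:].

Lemma linfP (f g : linf S R) : (forall s, f s = g s) -> f = g.
Proof. by move=> fg; apply/val_inj/funext. Qed.

Definition linf_norm (f : linf S R) : R := sup (range (fun s => `|f s|)).

Lemma linf_norm_ub (f : linf S R) s : `|f s| <= linf_norm f.
Proof.
have /asboolP/bounded_funP[M fM] := linf_boundedP f.
by apply: ub_le_sup; [exists M => _ [t _ <-]; exact: fM|exists s].
Qed.

Lemma linf_norm_empty (f : linf S R) : ~ inhabited S -> linf_norm f = 0.
Proof.
move=> S0; rewrite /linf_norm; suff -> : range (fun s => `|f s|) = set0.
  exact: sup0.
by rewrite -subset0 => y [s _ _]; apply: S0; constructor.
Qed.

Lemma linf_norm_ge0 (f : linf S R) : 0 <= linf_norm f.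
Proof.
have [[s]|S0] := pselect (inhabited S); last by rewrite linf_norm_empty.
exact: le_trans (linf_norm_ub f s).
Qed.

Lemma linf_norm_le (f : linf S R) (M : R) :
  0 <= M -> (forall s, `|f s| <= M) -> linf_norm f <= M.
Proof.
move=> M0 fM; have [[s]|S0] := pselect (inhabited S); last first.
  by rewrite linf_norm_empty.
by apply: ge_sup; [exists `|f s|; exists s|move=> _ [t _ <-]; exact: fM].
Qed.

Let linf_norm_ler_normD (f g : linf S R) :
  linf_norm (f + g) <= linf_norm f + linf_norm g.
Proof.
apply: linf_norm_le => [|s]; first by rewrite addr_ge0// linf_norm_ge0.
exact: le_trans (ler_normD _ _) (lerD (linf_norm_ub _ _) (linf_norm_ub _ _)).
Qed.

Let linf_norm_leZ (a : R) (f : linf S R) :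
  linf_norm (a *: f) <= `|a| * linf_norm f.
Proof.
apply: linf_norm_le => [|s]; first by rewrite mulr_ge0// linf_norm_ge0.
by rewrite /= normrM ler_wpM2l// linf_norm_ub.
Qed.

Let linf_norm_normrZ (a : R) (f : linf S R) :
  linf_norm (a *: f) = `|a| * linf_norm f.
Proof.
have [->|a0] := eqVneq a 0.
  apply/eqP; rewrite normr0 mul0r eq_le linf_norm_ge0 andbT.
  by have := linf_norm_leZ 0 f; rewrite normr0 mul0r.
apply/eqP; rewrite eq_le linf_norm_leZ/=.
have := linf_norm_leZ a^-1 (a *: f).
by rewrite scalerA mulVf// scale1r normfV mulrC ler_pdivlMr ?normr_gt0// mulrC.
Qed.

Let linf_norm_eq0 (f : linf S R) : linf_norm f = 0 -> f = 0.
Proof.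
move=> f0; apply: linfP => s; apply/eqP.
by rewrite -normr_le0 -f0 linf_norm_ub.
Qed.

HB.instance Definition _ := Lmodule_isNormed.Build R (linf S R)
  linf_norm_ler_normD linf_norm_normrZ linf_norm_eq0.

Lemma linf_normE (f : linf S R) : `|f| = sup (range (fun s => `|f s|)).
Proof. by []. Qed.

End linf_lmodule.

Section outer_integrals.
Context (R : realType) (d : measure_display) (Omega : measurableType d).
Variable P : probability Omega R.
Local Open Scope ereal_scope.

Definition outer_prob (A : set Omega) : \bar R :=
  ereal_inf [set P B | B in [set B | measurable B /\ A `<=` B]].

Definition inner_prob (A : set Omega) : \bar R :=
  ereal_sup [set P B | B in [set B | measurable B /\ B `<=` A]].

(* The integral of U exists in the extended sense; this excludes the case
   +oo - +oo, in which the library assigns a junk value to the integral. *)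
Definition integral_exists (U : Omega -> \bar R) : Prop :=
  \int[P]_w U^\+ w < +oo \/ \int[P]_w U^\- w < +oo.

Definition outer_expectation (X : Omega -> \bar R) : \bar R :=
  ereal_inf [set \int[P]_w U w | U in
    [set U : Omega -> \bar R | [/\ measurable_fun setT U,
      integral_exists U & forall w, X w <= U w]]].

End outer_integrals.

Section weak_convergence.
Context (R : realType) (d : measure_display) (Omega : measurableType d).
Variables (P : probability Omega R) (D : ptopologicalType).

Definition borel_measurable (X : Omega -> D) : Prop :=
  measurable_fun setT (X : Omega -> g_sigma_algebraType (@open D)).

Definition tight (X : Omega -> D) : Prop :=
  forall e : R, 0 < e ->
    exists2 K : set D, compact K & ((1 - e)%:E <= P (X @^-1` K))%E.

(* Weak convergence in the sense of Hoffmann-Jorgensen: the maps X_ N need not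
   be measurable. *)
Definition weakly_converges (X_ : nat -> Omega -> D) (X : Omega -> D) : Prop :=
  forall h : D -> R, continuous h -> bounded_fun h ->
    outer_expectation P (fun w => (h (X_ N w))%:E) @[N --> \oo] -->
      ('E_P[h \o X])%E.

End weak_convergence.

Section level_sets.
Context (S : Type) (R : realType).

Definition lower_set (mu : S -> R) (f : S -> \bar R) : set S :=
  [set s | ((mu s)%:E < f s)%E].

Definition upper_set (mu : S -> R) (f : S -> \bar R) : set S :=
  [set s | ((mu s)%:E > f s)%E].

End level_sets.

Section normalized_error.
Context (S : Type) (R : realType) (sigma : linf S R) (o : R).
Hypotheses (o_gt0 : 0 < o) (sigma_gt : forall s, o < sigma s).

Lemma normalized_error_bounded (mu nu : linf S R) (t : R) :
  (fun s => (nu s - mu s) / (t * sigma s)) \in bounded_pred S R.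
Proof.
apply/asboolP/bounded_funP; exists (`|nu - mu| * (`|t^-1| * o^-1)) => s.
have s0 : 0 < sigma s := lt_trans o_gt0 (sigma_gt s).
rewrite normrM invfM normrM ler_pM//; first exact: (linf_norm_ub (nu - mu)).
rewrite ler_wpM2l// normfV gtr0_norm// lef_pV2 ?posrE//.
exact: ltW.
Qed.

(* The quotient (nu - mu) / (t sigma) lies in l^oo(S) because sigma is bounded
   away from 0, hence the dependency on o_gt0 and sigma_gt. *)
Definition normalized_error (mu nu : linf S R) (t : R) : linf S R :=
  Linf (normalized_error_bounded mu nu t).

End normalized_error.

(* Main.v *)
Require Import Defs.
From HB Require Import structures.
From mathcomp Require Import all_boot all_order all_algebra.
From mathcomp Require Import all_classical all_reals all_analysis.
From mathcomp Require Import measurable_realfun.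
From mathcomp Require Import lra.

(** Taking [c = mu] shows that the inclusions for all [c] say exactly that
    [`|muhat_N - mu| <= tau_N q sigma] everywhere, that is [`|G_N| <= q] for the
    supremum norm. The two bounds are then portmanteau inequalities for closed
    and open balls: the upper bound for [b <= phi] with [phi] continuous follows
    from weak convergence by continuous cut-offs of [phi]; it is used with
    [phi = - `|g|], and with [phi = `|g|] after taking complements. *)

Set Implicit Arguments.
Unset Strict Implicit.
Unset Printing Implicit Defensive.

Import Order.TTheory GRing.Theory Num.Theory.
Import numFieldNormedType.Exports.

Local Open Scope classical_set_scope.
Local Open Scope ring_scope.

Lemma le_limn_esup (R : realType) (u v : (\bar R)^nat) :
  (forall n, u n <= v n)%E -> (limn_esup u <= limn_esup v)%E.
Proof.
move=> uv; rewrite !limn_esup_lim; apply: lee_lim; [exact: is_cvg_esups..|].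
apply: nearW => n; apply: ge_ereal_sup => _ [N nN <-].
by apply: le_ereal_sup_tmp; exists (v N) => //; exists N.
Qed.

(** * Inner and outer probability *)

Section outer_prob.
Context (R : realType) (d : measure_display) (Omega : measurableType d).
Variable P : probability Omega R.
Local Open Scope ereal_scope.

Lemma outer_prob_ge0 (A : set Omega) : 0 <= outer_prob P A.
Proof. by apply: le_ereal_inf_tmp => _ [B _ <-]. Qed.

Lemma outer_prob_le1 (A : set Omega) : outer_prob P A <= 1.
Proof.
apply: ge_ereal_inf; exists (P setT); first by exists setT.
by rewrite probability_setT.
Qed.

Lemma outer_prob_fin_num (A : set Omega) : outer_prob P A \is a fin_num.
Proof.
rewrite ge0_fin_numE ?outer_prob_ge0//.
exact: le_lt_trans (outer_prob_le1 A) (ltry _).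
Qed.

Lemma outer_prob_subset (A B : set Omega) :
  A `<=` B -> outer_prob P A <= outer_prob P B.
Proof.
move=> AB; apply: le_ereal_inf_tmp => _ [C [mC BC] <-].
by apply: ereal_inf_lbound; exists C => //; split=> // w /AB /BC.
Qed.

Lemma inner_prob_setC (A : set Omega) :
  inner_prob P (~` A) = 1 - outer_prob P A.
Proof.
apply/eqP; rewrite eq_le; apply/andP; split.
  apply: ge_ereal_sup => _ [B [mB BA] <-].
  rewrite leeBrDl ?outer_prob_fin_num// -leeBrDr ?fin_num_measure//.
  rewrite -probability_setC//; apply: ereal_inf_lbound.
  exists (~` B) => //; split; first exact: measurableC.
  by move=> w Aw /BA.
rewrite leeBlDr ?outer_prob_fin_num// addeC.
(* Finiteness is what permits moving this term across an inequality in [\bar R]. *)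
have fin : inner_prob P (~` A) \is a fin_num.
  rewrite ge0_fin_numE.
    apply: (@le_lt_trans _ _ 1); last exact: ltry.
    by apply: ge_ereal_sup => _ [B [mB _] <-]; exact: probability_le1.
  apply: ereal_sup_ubound; exists set0; last by rewrite measure0.
  by split=> //; exact: sub0set.
rewrite -leeBlDr//; apply: le_ereal_inf_tmp => _ [B [mB AB] <-].
rewrite leeBlDr// -leeBlDl ?fin_num_measure// -probability_setC//.
apply: ereal_sup_ubound; exists (~` B) => //; split; first exact: measurableC.
by move=> w Bw /AB.
Qed.

(** Markov's inequality at level 1: for a measurable majorant [U] of [X], the set where [1 <= U] is
    measurable and contains [A], and its indicator is at most [U] because [U] is nonnegative. *)
Lemma outer_prob_le_expectation (A : set Omega) (X : Omega -> \bar R) :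
  (forall w, 0 <= X w) -> (forall w, A w -> 1 <= X w) ->
  outer_prob P A <= outer_expectation P X.
Proof.
move=> X0 X1; apply: le_ereal_inf_tmp => _ [U [mU _ XU] <-].
have mB : measurable [set w | 1 <= U w].
  rewrite -[X in measurable X]setTI.
  exact: (measurable_lee measurableT (measurable_cst _) mU).
apply: (@le_trans _ _ (P [set w | 1 <= U w])).
  apply: ereal_inf_lbound; exists [set w | 1 <= U w] => //; split=> // w Aw /=.
  exact: le_trans (X1 w Aw) (XU w).
rewrite -(setIT [set w | 1 <= U w]) -integral_indic//.
apply: ge0_le_integral => //.
- by apply/measurable_EFinP; exact: measurable_indic.
- move=> w _; rewrite indicE.
  have [|_] := boolP (w \in _); first by move/set_mem.
  exact: le_trans (X0 w) (XU w).
Qed.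

End outer_prob.

(** * Portmanteau inequalities for level sets of a continuous function *)

Section portmanteau.
Context (R : realType) (d : measure_display) (Omega : measurableType d).
Variables (P : probability Omega R) (D : ptopologicalType).
Variables (X_ : nat -> Omega -> D) (X : Omega -> D).
Hypotheses (X_borel : borel_measurable X) (X_cvg : weakly_converges P X_ X).

Lemma borel_measurable_open (B : set D) : open B -> measurable (X @^-1` B).
Proof.
move=> oB; rewrite -[X in measurable X]setTI; apply: X_borel => //.
exact: sub_gen_smallest.
Qed.

Lemma borel_measurable_comp (phi : D -> R) :
  continuous phi -> measurable_fun setT (phi \o X).
Proof.
move=> /continuousP cphi.
apply: (measurability _ (RGenOpens.measurableE R)) => _ [_ [a [b ->] <-]].
rewrite setTI comp_preimage; apply: borel_measurable_open.
by apply: cphi; exact: interval_open.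
Qed.

Lemma borel_measurable_gt (phi : D -> R) (a : R) :
  continuous phi -> measurable [set w | a < phi (X w)].
Proof.
move=> /continuousP cphi; apply: (@borel_measurable_open [set x | a < phi x]).
by apply: (cphi [set x | a < x]); exact: open_gt.
Qed.

(** The gap between [a] and [b] leaves room for a continuous [h] lying between the indicators of
    [b <= phi] and [a < phi]. Weak convergence applies to [h], and the two indicators give the two
    sides. *)
Lemma limn_esup_outer_prob_lt (phi : D -> R) (a b : R) :
  continuous phi -> a < b ->
  (limn_esup (fun N => outer_prob P [set w | (b <= phi (X_ N w))%R])
    <= P [set w | (a < phi (X w))%R])%E.
Proof.
move=> cphi ab.
(* The affine rescaling of [phi] sending [a] to 0 and [b] to 1, clamped to the unit interval. *)
pose h : D -> R := cst 0 \max (cst 1 \min (fun x => (phi x - a) / (b - a))).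
have ba0 : 0 < b - a by rewrite subr_gt0.
have h0 x : 0 <= h x by rewrite /h/= le_max lexx.
have h1 x : h x <= 1 by rewrite /h/= ge_max ler01 ge_min lexx.
have hb x : b <= phi x -> 1 <= h x.
  move=> bx; rewrite /h/= le_max; apply/orP; right.
  by rewrite le_min lexx ler_pdivlMr// mul1r lerD2r.
have ha x : phi x <= a -> h x = 0.
  move=> xa; apply/max_idPl; rewrite ge_min; apply/orP; right.
  by rewrite pmulr_lle0 ?invr_gt0// subr_le0.
have ch : continuous h.
  move=> x; apply: continuous_max; first exact: cvg_cst.
  apply: continuous_min; first exact: cvg_cst.
  by apply: cvgMl; apply: cvgB; [exact: cphi|exact: cvg_cst].
have bh : bounded_fun h.
  by apply/Defs.bounded_funP; exists 1 => x; rewrite ger0_norm.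
have mh := borel_measurable_comp ch.
have mB := borel_measurable_gt a cphi.
have /cvg_limn_einf_sup[_ E] := X_cvg ch bh.
apply: (@le_trans _ _
    (limn_esup (fun N => outer_expectation P (fun w => (h (X_ N w))%:E)))).
  apply: le_limn_esup => N.
  by apply: outer_prob_le_expectation => w; rewrite lee_fin//; exact: hb.
rewrite E unlock.
rewrite -(setIT [set w | a < phi (X w)]) -integral_indic//.
apply: ge0_le_integral => //.
- by move=> w _; rewrite lee_fin; exact: h0.
- exact/measurable_EFinP.
- by apply/measurable_EFinP; exact: measurable_indic.
- move=> w _; rewrite lee_fin indicE /=; have [_|] := boolP (w \in _) => //.
  by move/negP; rewrite inE/= => /negP; rewrite -leNgt => /ha ->.
Qed.

(** Let [a] increase to [b] in the previous bound: the events [a < phi (X w)] decrease to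
    [b <= phi (X w)], and [P] is continuous from above. *)
Lemma limn_esup_outer_prob_le (phi : D -> R) (b : R) : continuous phi ->
  (limn_esup (fun N => outer_prob P [set w | (b <= phi (X_ N w))%R])
    <= P [set w | (b <= phi (X w))%R])%E.
Proof.
move=> cphi.
pose F n := [set w | b - n.+1%:R^-1 < phi (X w)].
have mF n : measurable (F n) by exact: borel_measurable_gt.
have FE : [set w | b <= phi (X w)] = \bigcap_n F n.
  apply/seteqP; split=> w /= => [bw n _|Fw].
    by rewrite /F/= (lt_le_trans _ bw)// ltrBlDr ltrDl invr_gt0.
  (* If [phi (X w) < b], the Archimedean property gives [k] with [phi (X w) < b - k.+1%:R^-1],
     against membership in [F k]. *)
  rewrite leNgt; apply/negP => /ltr_add_invr[k]; rewrite -ltrBrDr.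
  by move=> /lt_trans /(_ (Fw k Logic.I)); rewrite ltxx.
rewrite FE; apply: (@cvge_ge _ \oo _ _ (P \o F)).
  apply: nearW => n /=; apply: limn_esup_outer_prob_lt => //.
  by rewrite ltrBlDr ltrDl invr_gt0.
apply: nonincreasing_cvg_mu => //.
- exact: le_lt_trans (probability_le1 _ _) (ltry _).
- exact: bigcap_measurable.
- move=> n m nm; apply/subsetPset => w; apply: le_lt_trans.
  by rewrite lerD2l lerN2 lef_pV2 ?posrE// ler_nat.
Qed.

Lemma limn_einf_inner_prob_ge (phi : D -> R) (b : R) : continuous phi ->
  (P [set w | (phi (X w) < b)%R]
    <= limn_einf (fun N => inner_prob P [set w | (phi (X_ N w) <= b)%R]))%E.
Proof.
move=> cphi.
have leCE (Y : Omega -> D) :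
    [set w | phi (Y w) <= b] = ~` [set w | b < phi (Y w)].
  by apply/seteqP; split=> w /=; rewrite leNgt => /negP.
have ltCE : [set w | phi (X w) < b] = ~` [set w | b <= phi (X w)].
  by apply/seteqP; split=> w /=; rewrite ltNge => /negP.
under [X in limn_einf X]eq_fun do rewrite leCE inner_prob_setC.
(* The lower limit of [1 - u] is 1 minus the upper limit of [u]. *)
rewrite limn_einf_shift// (limn_einfN (fun N => outer_prob P _)).
have mB : measurable [set w | b <= phi (X w)].
  rewrite -[X in measurable X]setCK -ltCE.
  apply: measurableC; rewrite (_ : [set w | _] = [set w | - b < - phi (X w)]).
    apply: (@borel_measurable_gt (fun x => - phi x)) => x.
    by apply: cvgN; exact: cphi.
  by apply/seteqP; split=> w /=; rewrite ltrN2.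
rewrite ltCE probability_setC// leeD2l// leeN2.
apply: le_trans (limn_esup_outer_prob_le b cphi).
(* The complement is the strict event [b < phi]; enlarging it to [b <= phi] makes the upper bound
   applicable. *)
by apply: le_limn_esup => N; apply: outer_prob_subset => w /ltW.
Qed.

End portmanteau.

(** * From inclusions of level sets to the supremum norm *)

(** At [c = mu] both right-hand sets are empty, so the left-hand ones are too, which gives the two
    halves of the absolute value bound. The converse is pointwise arithmetic. *)
Lemma inclusionsP (S : Type) (R : realType) (mu nu e : S -> R) :
  (forall c : S -> \bar R,
    lower_set nu (fun s => c s - (e s)%:E)%E `<=` lower_set mu c /\
    upper_set nu (fun s => c s + (e s)%:E)%E `<=` upper_set mu c) <->
  forall s, `|nu s - mu s| <= e s.
Proof.
split=> [incl s|le_e c].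
  have [lo up] := incl (EFin \o mu).
  have muN : ~ ((mu s)%:E < (mu s)%:E)%E by rewrite ltxx.
  rewrite ler_norml; apply/andP; split; rewrite leNgt; apply/negP => lt_e.
    by apply/muN/lo; rewrite /lower_set/= -EFinB lte_fin; lra.
  by apply/muN/up; rewrite /upper_set/= -EFinD lte_fin; lra.
split=> s; have := le_e s; rewrite ler_norml => /andP[lo up].
  (* At [c s = +oo] the conclusion is automatic; at [-oo] the shift changes nothing and the premise
     fails. The upper sets are symmetric. *)
  rewrite /lower_set/=; case: (c s) => [r|_|]; rewrite ?ltry//=.
  by rewrite -EFinB !lte_fin; lra.
rewrite /upper_set/=; case: (c s) => [r| |_]; rewrite ?ltNyr//=.
by rewrite -EFinD !lte_fin; lra.
Qed.

Lemma ereal_sup_linf (S : Type) (R : realType) (g : linf S R) : inhabited S ->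
  ereal_sup (range (fun s => `|g s|%:E)) = `|g|%:E.
Proof.
move=> [s0]; rewrite linf_normE -ereal_sup_EFin.
- by rewrite -image_comp.
- by exists `|g| => _ [s _ <-]; exact: linf_norm_ub.
- by exists `|g s0|, s0.
Qed.

Lemma le_normalized_error (S : Type) (R : realType) (sigma : linf S R) (o : R)
    (o_gt0 : 0 < o) (sigma_gt : forall s, o < sigma s)
    (mu nu : linf S R) (t q : R) : 0 < t -> inhabited S ->
  `|normalized_error o_gt0 sigma_gt mu nu t| <= q <->
  forall s, `|nu s - mu s| <= t * q * sigma s.
Proof.
move=> t0 [s0]; have ts s : 0 < t * sigma s.
  by rewrite mulr_gt0// (lt_trans o_gt0).
have nE s : (`|normalized_error o_gt0 sigma_gt mu nu t s| <= q) =
    (`|nu s - mu s| <= t * q * sigma s).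
  by rewrite /= normrM normfV (gtr0_norm (ts s)) ler_pdivrMr// mulrCA mulrA.
split=> [le_q s|le_nu].
  by rewrite -nE (le_trans _ le_q)// linf_norm_ub.
have le_q s : `|normalized_error o_gt0 sigma_gt mu nu t s| <= q by rewrite nE.
(* The sign of [q] is not assumed: [0 <= q] follows from the bound at the point [s0]. *)
by apply: linf_norm_le => //; exact: le_trans (le_q s0).
Qed.

Theorem corollary1 (R : realType) (S : metricType R)
  (d : measure_display) (Omega : measurableType d) (P : probability Omega R)
  (mu : linf S R) (muhat : nat -> Omega -> linf S R)
  (tau : nat -> R) (tau_gt0 : forall N, 0 < tau N)
  (tau_cvg0 : tau N @[N --> \oo] --> (0 : R))
  (sigma : linf S R) (o O : R) (o_gt0 : 0 < o)
  (sigma_gt : forall s, o < sigma s) (sigma_lt : forall s, sigma s < O)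
  (q : R) (G : Omega -> linf S R)
  (G_borel : borel_measurable G) (G_tight : tight P G)
  (GN_cvg : weakly_converges P
     (fun N w => normalized_error o_gt0 sigma_gt mu (muhat N w) (tau N)) G) :
  let inclusions (N : nat) : set Omega := [set w | forall c : S -> \bar R,
    lower_set (muhat N w) (fun s => c s - (tau N * q * sigma s)%:E)%E
      `<=` lower_set mu c /\
    upper_set (muhat N w) (fun s => c s + (tau N * q * sigma s)%:E)%E
      `<=` upper_set mu c] in
  (P [set w | ereal_sup (range (fun s => `|G w s|%:E)) < q%:E]
     <= limn_einf (fun N => inner_prob P (inclusions N)))%E /\
  (limn_esup (fun N => outer_prob P (inclusions N))
     <= P [set w | ereal_sup (range (fun s => `|G w s|%:E)) <= q%:E])%E.
Proof.
move=> inclusions.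
have [S0|S0] := pselect (inhabited S); last first.
  (* For empty [S] the supremum is [-oo], whereas the norm is [0]. *)
  have supE w : ereal_sup (range (fun s => `|G w s|%:E)) = -oo%E.
    apply/eqP; rewrite -leeNy_eq; apply: ge_ereal_sup => _ [s _ <-].
    by case: S0.
  (* The full event is written as a complement so that [inner_prob_setC] computes its inner
     probability. *)
  have inclE N : inclusions N = ~` set0.
    by rewrite setC0 -subTset => w _ c; split=> s; case: S0.
  have outer0 : outer_prob P set0 = 0%E.
    apply/eqP; rewrite eq_le outer_prob_ge0 andbT.
    by apply: ereal_inf_lbound; exists set0; [split|rewrite measure0].
  have le_cst (x : \bar R) : limn_einf (fun=> x) = x /\ limn_esup (fun=> x) = x.
    by have [-> ->] := cvg_limn_einf_sup (@cvg_cst _ x nat \oo _).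
  under [X in limn_einf X]eq_fun do rewrite inclE inner_prob_setC outer0 sube0.
  under [X in limn_esup X]eq_fun do rewrite inclE.
  rewrite (le_cst _).1 (le_cst _).2.
  split; rewrite (_ : [set w | _] = setT) ?probability_setT ?outer_prob_le1//.
    by rewrite -subTset => w _ /=; rewrite supE ltNyr.
  by rewrite -subTset => w _ /=; rewrite supE leNye.
pose GN N w := normalized_error o_gt0 sigma_gt mu (muhat N w) (tau N).
have inclE N : inclusions N = [set w | `|GN N w| <= q].
  apply/seteqP; split=> w.
    move=> /inclusionsP.
    by move=> /(le_normalized_error o_gt0 sigma_gt _ _ _ (tau_gt0 N) S0).
  by move=> /(le_normalized_error _ _ _ _ _ (tau_gt0 N) S0) /inclusionsP.
under [X in limn_einf X]eq_fun do rewrite inclE.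
under [X in limn_esup X]eq_fun do rewrite inclE.
under eq_set do rewrite ereal_sup_linf// lte_fin.
under [X in (_ <= P X)%E]eq_set do rewrite ereal_sup_linf// lee_fin.
have cn : continuous (fun g : linf S R => `|g|) by exact: norm_continuous.
split; first exact: (limn_einf_inner_prob_ge G_borel GN_cvg q cn).
have cN : continuous (fun g : linf S R => - `|g|).
  by move=> g; exact: (cvgN (cn g)).
(* Negating the norm and the level turns the closed ball into a superlevel set. *)
have := limn_esup_outer_prob_le G_borel GN_cvg (- q) cN.
rewrite (_ : [set w | - q <= - `|G w|] = [set w | `|G w| <= q]); last first.
  by apply/seteqP; split=> w /=; rewrite lerN2.
apply: le_trans; apply: le_limn_esup => N; apply: outer_prob_subset => w /=.
by rewrite lerN2.
Qed.
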